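(* Let $p$ be a prime and $n$ a non-negative integer, and let $P$ and $Q$ be finite groups, both of order $p^n$ and both belonging to the class $CP_2$. Then $\psi(P)=\psi(Q)$ if and only if there is a bijection $f:P\to Q$ such that $o(f(x))=o(x)$ for all $x\in P$.
   Context: For a finite group $G$ and $x\in G$, $o(x)$ is the order of $x$, and $\psi(G)=\sum_{x\in G}o(x)$. $CP_2$ is the class of finite groups $G$ such that $o(xy)\le\max\{o(x),o(y)\}$ for all $x,y\in G$. *)

(* Defs.v *)
From mathcomp Require Import all_boot all_fingroup.
Set Implicit Arguments.
Unset Strict Implicit.
Unset Printing Implicit Defensive.

Local Open Scope group_scope.

Definition psi (gT : finGroupType) (G : {group gT}) : nat :=
  (\sum_(x in G) #[x])%N.

Definition CP2 (gT : finGroupType) (G : {group gT}) : Prop :=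
  {in G &, forall x y, #[x * y] <= maxn #[x] #[y]}.

(* Functions are total on the ambient types; only the restriction of f to P
   matters here. *)
Definition bijection_onto (gT rT : finGroupType)
    (P : {group gT}) (Q : {group rT}) (f : gT -> rT) : Prop :=
  {in P &, injective f} /\ f @: P = Q.

(* Main.v *)
Require Import Defs.
From mathcomp Require Import all_boot all_fingroup.
Set Implicit Arguments.
Unset Strict Implicit.
Unset Printing Implicit Defensive.

Local Open Scope group_scope.

(** Bijections that preserve orders obviously preserve [psi].  Conversely, let
    G be a CP2 group of order p ^ n.  The CP2 condition says exactly that the
    elements of order at most p ^ k form a subgroup, so by Lagrange there are
    p ^ a_k of them, where a_k is nondecreasing in k.  Abel summation turns
    [psi] into
      psi G + (p - 1) * \sum_(k < n) p ^ (a_k + k) = p ^ n * p ^ n.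
    The exponents a_k + k are strictly increasing, so the sum is an expansion
    in base p with all digits 0 or 1; by uniqueness of such expansions [psi G]
    determines every a_k with k < n, and a_k = n for k >= n.  Two such groups
    with the same [psi] thus have equally many elements of each order
    ([card_order_le_psi]), and matching elements of equal order gives the
    bijection ([same_card_le_bijection]). *)

(** Differences of consecutive cumulative counts show that e and e' take each
    value equally often.  Listing A by increasing e and B by increasing e',
    elements in the same position then have the same value, so f sends the
    i-th element of the first list to the i-th of the second. *)
Lemma same_card_le_bijection (T T' : finType) (y0 : T')
    (A : {set T}) (B : {set T'}) (e : T -> nat) (e' : T' -> nat) :
    (forall k, #|[set x in A | e x <= k]| = #|[set y in B | e' y <= k]|) ->
  exists f : T -> T',
    [/\ {in A &, injective f}, f @: A = B & {in A, forall x, e' (f x) = e x}].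
Proof.
move=> eq_le.
have count_card (U : finType) (C : {set U}) (h : U -> nat) (a : pred nat) :
  count a [seq h x | x <- enum C] = #|[set x in C | a (h x)]|.
  rewrite count_map -size_filter cardE; apply: perm_size.
  apply: uniq_perm => [||x]; [exact/filter_uniq/enum_uniq | exact: enum_uniq |].
  by rewrite mem_filter !mem_enum !inE andbC.
have card_leS (U : finType) (C : {set U}) (h : U -> nat) k :
  #|[set x in C | h x <= k.+1]|
    = (#|[set x in C | h x <= k]| + #|[set x in C | h x == k.+1]|)%N.
  rewrite -(count_card U C h (fun m => m <= k.+1)).
  rewrite -(count_card U C h (fun m => m <= k)) -(count_card U C h (pred1 k.+1)).
  rewrite -[RHS]count_predUI [X in (_ + X)%N](@eq_count _ _ pred0) => [|m /=].
    by rewrite count_pred0 addn0; apply: eq_count => m /=; rewrite leq_eqVlt orbC.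
  by apply/negP => /andP[le_mk /eqP eq_m]; rewrite eq_m ltnn in le_mk.
have eq_fibers : perm_eq [seq e x | x <- enum A] [seq e' y | y <- enum B].
  apply/allP => m _; rewrite /= !count_card; apply/eqP.
  case: m => [|k] /=.
    have := eq_le 0; congr (_ = _); apply: eq_card => x;
    by rewrite !inE leqn0.
  by apply/eqP; rewrite -(eqn_add2l #|[set x in A | e x <= k]|) -card_leS;
     rewrite !eq_le -card_leS.
pose s := sort (relpre e leq) (enum A).
pose t := sort (relpre e' leq) (enum B).
have eq_st : map e s = map e' t.
  rewrite /s /t -!sort_map.
  by apply/(perm_sortP leq_total leq_trans anti_leq).
have size_st : size s = size t by rewrite -(size_map e) eq_st size_map.
have mem_s x : (x \in s) = (x \in A) by rewrite mem_sort mem_enum.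
have mem_t y : (y \in t) = (y \in B) by rewrite mem_sort mem_enum.
have s_uniq : uniq s by rewrite sort_uniq enum_uniq.
have t_uniq : uniq t by rewrite sort_uniq enum_uniq.
pose f x := nth y0 t (index x s).
have ltA x : x \in A -> index x s < size t by rewrite -size_st index_mem mem_s.
exists f; split=> [x1 x2 Ax1 Ax2 /eqP||x Ax].
- rewrite nth_uniq ?ltA // => /eqP /(congr1 (nth x1 s)).
  by rewrite !nth_index ?mem_s.
- apply/setP => y; apply/imsetP/idP => [[x Ax ->]|By].
    by rewrite -mem_t mem_nth ?ltA.
  have lt_y : index y t < size s by rewrite size_st index_mem mem_t.
  have [x0 _] : exists x0 : T, true by case: (s) lt_y => // x0; exists x0.
  exists (nth x0 s (index y t)); first by rewrite -mem_s mem_nth.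
  by rewrite /f index_uniq // nth_index ?mem_t.
- rewrite /f -(nth_map _ 0) ?ltA // -eq_st (nth_map x) ?size_st ?ltA //.
  by rewrite nth_index ?mem_s.
Qed.

(** By induction the lower terms add up to less than the last one, so the whole
    sum is below twice the last term, hence below the next power of p. *)
Lemma sum_incr_pow_lt (p : nat) (b : nat -> nat) (N : nat) : 1 < p ->
  (forall k, b k < b k.+1) -> (\sum_(k < N) p ^ b k < p ^ b N)%N.
Proof.
move=> p_gt1 b_incr; have p_gt0 := ltnW p_gt1.
elim: N => [|N IHN]; first by rewrite big_ord0 expn_gt0 p_gt0.
rewrite big_ord_recr /=; apply: (@leq_trans (p ^ (b N).+1)).
  apply: (@leq_trans (p ^ b N + p ^ b N)); first by rewrite ltn_add2r.
  by rewrite addnn -mul2n expnS leq_mul2r p_gt1 orbT.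
by rewrite leq_pexp2l.
Qed.

(** The leading exponent can be read off as the base-p logarithm of the sum,
    so expansions are peeled from the top. *)
Lemma sum_incr_pow_inj (p : nat) (b c : nat -> nat) (N : nat) : 1 < p ->
    (forall k, b k < b k.+1) -> (forall k, c k < c k.+1) ->
    (\sum_(k < N) p ^ b k = \sum_(k < N) p ^ c k)%N ->
  forall k, k < N -> b k = c k.
Proof.
move=> p_gt1 b_incr c_incr.
have top d M : (forall k, d k < d k.+1) ->
    trunc_log p (\sum_(k < M.+1) p ^ d k) = d M.
  move=> d_incr; apply: trunc_log_eq => //; rewrite big_ord_recr /= leq_addl /=.
  apply: (@leq_trans (p ^ d M + p ^ d M)).
    by rewrite ltn_add2r sum_incr_pow_lt.
  by rewrite addnn -mul2n expnS leq_mul2r p_gt1 orbT.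
elim: N => // N IHN eq_sum.
have eq_N : b N = c N by rewrite -(top b N) // eq_sum top.
move: eq_sum; rewrite !big_ord_recr /= eq_N => /addIn /IHN eq_lt k.
by rewrite ltnS leq_eqVlt => /predU1P[-> //|]; apply: eq_lt.
Qed.

Lemma group_set_order_le (gT : finGroupType) (G : {group gT}) (m : nat) :
  CP2 G -> 0 < m -> group_set [set x in G | #[x] <= m].
Proof.
move=> cpG m_gt0; apply/group_setP; split=> [|x y].
  by rewrite inE group1 order1.
rewrite !inE => /andP[Gx ox] /andP[Gy oy]; rewrite groupM //=.
by apply: leq_trans (cpG x y Gx Gy) _; rewrite geq_max ox.
Qed.

Section PrimePower.

Variables (p n : nat) (p_prime : prime p).

Lemma order_pow_logn (gT : finGroupType) (G : {group gT}) (x : gT) :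
  #|G| = (p ^ n)%N -> x \in G ->
  #[x] = (p ^ logn p #[x])%N /\ logn p #[x] <= n.
Proof.
move=> oG Gx; have : #[x] %| p ^ n by rewrite -oG cardSg ?cycle_subG.
by case/(dvdn_pfactor _ _ p_prime) => k le_kn ->; rewrite pfactorK.
Qed.

(** For a CP2 group of order p ^ n this is the exponent a_k; taking a p-adic
    valuation makes it a function of G and k without any side condition. *)
Definition level_exp (gT : finGroupType) (G : {group gT}) (k : nat) : nat :=
  logn p #|[set x in G | logn p #[x] <= k]|.

Lemma card_level (gT : finGroupType) (G : {group gT}) (k : nat) :
    #|G| = (p ^ n)%N -> CP2 G ->
  #|[set x in G | logn p #[x] <= k]| = (p ^ level_exp G k)%N.
Proof.
move=> oG cpG.
have pk_gt0 : 0 < p ^ k by rewrite expn_gt0 prime_gt0.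
pose H := Group (group_set_order_le cpG pk_gt0).
have HE : [set x in G | logn p #[x] <= k] = H.
  apply/setP => x; rewrite !inE; apply: andb_id2l => Gx.
  rewrite -(leq_exp2l _ _ (prime_gt1 p_prime)).
  by have [<- _] := order_pow_logn oG Gx.
have : #|H| %| p ^ n.
  by rewrite -oG cardSg //; apply/subsetP => x; rewrite inE => /andP[].
rewrite /level_exp HE; case/(dvdn_pfactor _ _ p_prime) => a _ ->.
by rewrite pfactorK.
Qed.

(** This is what makes the exponents a_k + k strictly increasing. *)
Lemma level_exp_leS (gT : finGroupType) (G : {group gT}) (k : nat) :
  #|G| = (p ^ n)%N -> CP2 G -> level_exp G k <= level_exp G k.+1.
Proof.
move=> oG cpG; rewrite -(leq_exp2l _ _ (prime_gt1 p_prime)) -!card_level //.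
apply/subset_leq_card/subsetP => x; rewrite !inE => /andP[-> /=].
exact: leqW.
Qed.

(** Abel summation: each power p ^ e with e <= n is p ^ n minus the increments
    p ^ k.+1 - p ^ k for e <= k < n, and exchanging the sums counts, for each
    k, the elements of order at most p ^ k. *)
Lemma psi_Abel (gT : finGroupType) (G : {group gT}) :
    #|G| = (p ^ n)%N -> CP2 G ->
  (psi G + p.-1 * \sum_(k < n) p ^ (level_exp G k + k) = p ^ n * p ^ n)%N.
Proof.
move=> oG cpG.
have telescope e m :
    e <= m -> (p ^ e + \sum_(k < m | e <= k) p.-1 * p ^ k = p ^ m)%N.
  elim: m => [|m IHm]; first by rewrite leqn0 => /eqP->; rewrite big_ord0.
  rewrite leq_eqVlt => /predU1P[->|le_em].
    by rewrite big1 ?addn0 // => k; rewrite leqNgt ltn_ord.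
  rewrite big_mkcond big_ord_recr /= -big_mkcond /= -ltnS le_em addnA IHm //.
  by rewrite -mulSn prednK ?prime_gt0 // expnS.
have -> : (p.-1 * \sum_(k < n) p ^ (level_exp G k + k)
    = \sum_(x in G) \sum_(k < n | logn p #[x] <= k) p.-1 * p ^ k)%N.
  rewrite (exchange_big_dep xpredT) //= big_distrr; apply: eq_bigr => k _ /=.
  rewrite sum_nat_cond_const expnD -card_level // mulnCA.
  by congr (_ * _)%N; apply: eq_card => x; rewrite !inE.
rewrite /psi -big_split /= -{1}oG -sum_nat_const; apply: eq_bigr => x Gx.
by have [ox /telescope] := order_pow_logn oG Gx; rewrite -ox.
Qed.

Lemma card_order_le_psi (gT rT : finGroupType)
    (P : {group gT}) (Q : {group rT}) (k : nat) :
    #|P| = (p ^ n)%N -> #|Q| = (p ^ n)%N -> CP2 P -> CP2 Q -> psi P = psi Q ->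
  #|[set x in P | logn p #[x] <= k]| = #|[set y in Q | logn p #[y] <= k]|.
Proof.
move=> oP oQ cpP cpQ eq_psi; have p_gt1 := prime_gt1 p_prime.
have [lt_kn|le_nk] := ltnP k n; last first.
  have level_full (hT : finGroupType) (G : {group hT}) :
      #|G| = (p ^ n)%N -> #|[set x in G | logn p #[x] <= k]| = (p ^ n)%N.
    move=> oG; rewrite -[RHS]oG; apply: eq_card => x; rewrite inE andb_idr //.
    by move=> Gx; apply: leq_trans le_nk; case: (order_pow_logn oG Gx).
  by rewrite !level_full.
have incr (hT : finGroupType) (G : {group hT}) :
    #|G| = (p ^ n)%N -> CP2 G ->
  forall i, level_exp G i + i < level_exp G i.+1 + i.+1.
  by move=> oG cpG i; rewrite addnS ltnS leq_add2r level_exp_leS.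
rewrite !card_level //; congr (p ^ _)%N.
apply: (@addIn k); move: k lt_kn.
apply: (@sum_incr_pow_inj p (fun i => level_exp P i + i)%N
                            (fun i => level_exp Q i + i)%N) => //;
  [exact: incr | exact: incr |].
apply/eqP; rewrite -(@eqn_pmul2l p.-1) ?ltn_predRL //.
by rewrite -(eqn_add2l (psi P)) psi_Abel // eq_psi psi_Abel.
Qed.

End PrimePower.

Theorem theorem1p4 (p n : nat) (gT rT : finGroupType)
    (P : {group gT}) (Q : {group rT}) (p_prime : prime p)
    (oP : #|P| = (p ^ n)%N) (oQ : #|Q| = (p ^ n)%N)
    (cpP : CP2 P) (cpQ : CP2 Q) :
  psi P = psi Q <->
  exists f : gT -> rT,
    bijection_onto P Q f /\ {in P, forall x, #[f x] = #[x]}.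
Proof.
split=> [eq_psi | [f [[f_inj f_im] f_ord]]]; last first.
  by rewrite /psi -f_im big_imset //; apply: eq_bigr => x /f_ord.
have [k|f [f_inj f_im f_log]] := @same_card_le_bijection _ _ 1 P Q
    (fun x => logn p #[x]) (fun y => logn p #[y]).
  exact: (@card_order_le_psi p n).
exists f; split=> // x Px.
have Qfx : f x \in Q by rewrite -f_im imset_f.
have [-> _] := order_pow_logn p_prime oQ Qfx.
by rewrite f_log //; have [<- _] := order_pow_logn p_prime oP Px.
Qed.
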